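(* Let $R_1,R_2,\dots,R_n$ be commutative rings with identity. Then there is a ring isomorphism $$C\left(\mathrm{Max}\left(\prod_{i=1}^n R_i\right)\right)\cong\prod_{i=1}^n C\left(\mathrm{Max}(R_i)\right).$$
   Context: For a commutative ring $R$ with identity, $\mathrm{Max}(R)$ is the set of maximal ideals of $R$ with the Zariski (hull-kernel) topology, whose closed sets are the sets $\{M\in\mathrm{Max}(R): S\subseteq M\}$ for $S\subseteq R$. For a topological space $X$, $C(X)$ is the ring of all real-valued continuous functions on $X$ with pointwise operations. *)

(* Defs.v *)
From HB Require Import structures.
From mathcomp Require Import all_boot all_order all_algebra.
From mathcomp Require Import all_classical all_reals all_analysis.

Set Implicit Arguments.
Unset Strict Implicit.
Unset Printing Implicit Defensive.

Import Order.TTheory GRing.Theory Num.Theory.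
Import numFieldNormedType.Exports.

Local Open Scope classical_set_scope.
Local Open Scope ring_scope.

(* Rings are [comPzRingType]s, so the zero ring is allowed (as a factor, and as
   the empty product); it has no maximal ideal, and C(Max 0) is the zero ring.
   The predicate [idealr_closed] of ring_quotient is about proper ideals of
   nonzero rings only, hence the definitions below. *)
Section Ideals.
Context {A : comPzRingType}.

Definition is_ideal (I : set A) : Prop :=
  [/\ I 0, forall x y, I x -> I y -> I (x + y) & forall a x, I x -> I (a * x)].

Definition is_maximal_ideal (M : set A) : Prop :=
  [/\ is_ideal M, M != setT &
      forall I : set A, is_ideal I -> M `<=` I -> I = M \/ I = setT].

Lemma maximal_ideal_prime (M : set A) (a b : A) :
  is_maximal_ideal M -> M (a * b) -> M a \/ M b.
Proof.
move=> [[M0 MD MM] MT Mmax] Mab; case: (pselect (M a)) => Ma; [by left|right].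
pose I : set A := [set x | exists2 m, M m & exists r, x = m + r * a].
have idI : is_ideal I.
  split.
  - by exists 0 => //; exists 0; rewrite mul0r addr0.
  - move=> x y [m Mm [r ->]] [m' Mm' [r' ->]].
    exists (m + m'); first exact: MD.
    by exists (r + r'); rewrite mulrDl addrACA.
  - move=> c x [m Mm [r ->]]; exists (c * m); first exact: MM.
    by exists (c * r); rewrite mulrDr mulrA.
have MI : M `<=` I by move=> x Mx; exists x => //; exists 0; rewrite mul0r addr0.
case: (Mmax I idI MI) => IE.
  by exfalso; apply: Ma; rewrite -IE; exists 0 => //; exists 1; rewrite mul1r add0r.
have [m Mm [r e]] : I 1 by rewrite IE.
rewrite -(mul1r b) e mulrDl; apply: MD; first by rewrite mulrC; exact: MM.
by rewrite -mulrA; exact: MM.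
Qed.

End Ideals.

Record Max (A : comPzRingType) := MkMax {
  ideal_of_Max :> set A;
  ideal_of_MaxP : is_maximal_ideal ideal_of_Max }.

HB.instance Definition _ (A : comPzRingType) := gen_eqMixin (Max A).
HB.instance Definition _ (A : comPzRingType) := gen_choiceMixin (Max A).

Section Zariski.
Context {A : comPzRingType}.

Definition zariski_closed (S : set A) : set (Max A) :=
  [set M : Max A | S `<=` M].

Definition zariski_open : set_system (Max A) :=
  [set U | exists S : set A, ~` U = zariski_closed S].

Let zariski_openT : zariski_open setT.
Proof.
exists setT; rewrite setCT; apply/esym; rewrite -subset0 => M MT.
by have [_ /eqP + _] := ideal_of_MaxP M; apply; apply/seteqP; split.
Qed.

Let zariski_openI : setI_closed zariski_open.
Proof.
move=> U V [S US] [T VT].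
exists [set x | exists2 s, S s & exists2 t, T t & x = s * t].
rewrite setCI US VT; apply/seteqP; split=> [M|M STM].
  have [[_ _ MM] _ _] := ideal_of_MaxP M.
  case=> SM x [s Ss [t Tt ->]].
    by rewrite mulrC; apply: MM; exact: SM.
  by apply: MM; exact: SM.
case: (pselect (S `<=` M)) => [|/existsNP[s /not_implyP[Ss nMs]]]; first by left.
right=> t Tt; have : (M : set A) (s * t) by apply: STM; exists s => //; exists t.
by case/(maximal_ideal_prime (ideal_of_MaxP M)).
Qed.

Let zariski_open_bigU (I : Type) (f : I -> set (Max A)) :
  (forall i, zariski_open (f i)) -> zariski_open (\bigcup_i f i).
Proof.
move=> fo.
have /choice[S fS] : forall i, exists S : set A, ~` f i = zariski_closed S.
  exact: fo.
exists (\bigcup_i S i); rewrite setC_bigcup; apply/seteqP; split=> M.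
  move=> fM x [i _ Six].
  by have := fM i Logic.I; rewrite fS; apply.
by move=> SM i _; rewrite fS => x Six; apply: SM; exists i.
Qed.

HB.instance Definition _ := @isOpenTopological.Build (Max A)
  zariski_open zariski_openT zariski_openI zariski_open_bigU.

Lemma closed_MaxP (C : set (Max A)) :
  closed C <-> exists S : set A, C = zariski_closed S.
Proof.
rewrite -openC; split=> [[S]|[S CS]]; first by rewrite setCK; exists S.
by exists S; rewrite setCK.
Qed.

End Zariski.

(* The ring C(X), carried by the library's type of continuous functions. *)
Section ContinuousRing.
Context {X : topologicalType} {K : realType}.
Implicit Types f g h : continuousType X K.

Let cont_add_subproof f g : continuous (fun x => f x + g x).
Proof. by move=> x; apply: cvgD; exact: cts_fun. Qed.
Let cont_opp_subproof f : continuous (fun x => - f x).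
Proof. by move=> x; apply: cvgN; exact: cts_fun. Qed.
Let cont_mul_subproof f g : continuous (fun x => f x * g x).
Proof. by move=> x; apply: cvgM; exact: cts_fun. Qed.

Definition cont_zero : continuousType X K := cst 0.
Definition cont_one : continuousType X K := cst 1.
Definition cont_opp f : continuousType X K := mkcts (@cont_opp_subproof f).
Definition cont_add f g : continuousType X K := mkcts (@cont_add_subproof f g).
Definition cont_mul f g : continuousType X K := mkcts (@cont_mul_subproof f g).

Let cont_addA : associative cont_add.
Proof. by move=> f g h; apply/continuousEP => x; exact: addrA. Qed.
Let cont_addC : commutative cont_add.
Proof. by move=> f g; apply/continuousEP => x; exact: addrC. Qed.
Let cont_add0 : left_id cont_zero cont_add.
Proof. by move=> f; apply/continuousEP => x; exact: add0r. Qed.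
Let cont_addN : left_inverse cont_zero cont_opp cont_add.
Proof. by move=> f; apply/continuousEP => x; exact: addNr. Qed.

HB.instance Definition _ := GRing.isZmodule.Build (continuousType X K)
  cont_addA cont_addC cont_add0 cont_addN.

Let cont_mulA : associative cont_mul.
Proof. by move=> f g h; apply/continuousEP => x; exact: mulrA. Qed.
Let cont_mulC : commutative cont_mul.
Proof. by move=> f g; apply/continuousEP => x; exact: mulrC. Qed.
Let cont_mul1 : left_id cont_one cont_mul.
Proof. by move=> f; apply/continuousEP => x; exact: mul1r. Qed.
Let cont_mulD : left_distributive cont_mul cont_add.
Proof. by move=> f g h; apply/continuousEP => x; exact: mulrDl. Qed.

HB.instance Definition _ := GRing.Zmodule_isComPzRing.Build
  (continuousType X K) cont_mulA cont_mulC cont_mul1 cont_mulD.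

Lemma cont0E x : (0 : continuousType X K) x = 0. Proof. by []. Qed.
Lemma cont1E x : (1 : continuousType X K) x = 1. Proof. by []. Qed.
Lemma contNE f x : (- f) x = - f x. Proof. by []. Qed.
Lemma contDE f g x : (f + g) x = f x + g x. Proof. by []. Qed.
Lemma contME f g x : (f * g) x = f x * g x. Proof. by []. Qed.

End ContinuousRing.

(* The product of a finite family of rings, carried by the library's type of
   dependent finite functions; the library only has the ring structure for
   constant families. *)
Section ProductRing.
Context {I : finType} {A : I -> comPzRingType}.
Local Notation prodA := {dffun forall i : I, A i}.
Implicit Types f g h : prodA.

Definition prodr_zero : prodA := [ffun i => 0 : A i].
Definition prodr_one : prodA := [ffun i => 1 : A i].
Definition prodr_opp f : prodA := [ffun i => - f i : A i].
Definition prodr_add f g : prodA := [ffun i => f i + g i : A i].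
Definition prodr_mul f g : prodA := [ffun i => f i * g i : A i].

Let prodr_addA : associative prodr_add.
Proof. by move=> f g h; apply/ffunP => i; rewrite !ffunE addrA. Qed.
Let prodr_addC : commutative prodr_add.
Proof. by move=> f g; apply/ffunP => i; rewrite !ffunE addrC. Qed.
Let prodr_add0 : left_id prodr_zero prodr_add.
Proof. by move=> f; apply/ffunP => i; rewrite !ffunE add0r. Qed.
Let prodr_addN : left_inverse prodr_zero prodr_opp prodr_add.
Proof. by move=> f; apply/ffunP => i; rewrite !ffunE addNr. Qed.

HB.instance Definition _ := GRing.isZmodule.Build prodA
  prodr_addA prodr_addC prodr_add0 prodr_addN.

Let prodr_mulA : associative prodr_mul.
Proof. by move=> f g h; apply/ffunP => i; rewrite !ffunE mulrA. Qed.
Let prodr_mulC : commutative prodr_mul.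
Proof. by move=> f g; apply/ffunP => i; rewrite !ffunE mulrC. Qed.
Let prodr_mul1 : left_id prodr_one prodr_mul.
Proof. by move=> f; apply/ffunP => i; rewrite !ffunE mul1r. Qed.
Let prodr_mulD : left_distributive prodr_mul prodr_add.
Proof. by move=> f g h; apply/ffunP => i; rewrite !ffunE mulrDl. Qed.

HB.instance Definition _ := GRing.Zmodule_isComPzRing.Build prodA
  prodr_mulA prodr_mulC prodr_mul1 prodr_mulD.

Lemma prodr0E i : (0 : prodA) i = 0. Proof. exact: ffunE. Qed.
Lemma prodr1E i : (1 : prodA) i = 1. Proof. exact: ffunE. Qed.
Lemma prodrNE f i : (- f) i = - f i. Proof. exact: ffunE. Qed.
Lemma prodrDE f g i : (f + g) i = f i + g i. Proof. exact: ffunE. Qed.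
Lemma prodrME f g i : (f * g) i = f i * g i. Proof. exact: ffunE. Qed.

End ProductRing.

Definition ring_isomorphic (A B : pzRingType) : Prop :=
  exists f : {rmorphism A -> B}, bijective f.

(* Main.v *)
From HB Require Import structures.
Require Import Defs.
From mathcomp Require Import all_boot all_order all_algebra.
From mathcomp Require Import all_classical all_reals all_analysis.
Import numFieldNormedType.Exports.

(** Write P for the product of the R_i and p_i for its projections.  A surjection
    of rings induces, by taking preimages of maximal ideals, a closed embedding
    of maximal spectra whose image consists of the maximal ideals containing the
    kernel ([pullback_continuous], [pullback_closed], [pullback_of_ker]).  The
    kernel of p_i is contained in a maximal ideal N as soon as N misses the
    idempotent e_i, the unit vector at i.  Since the e_i sum to 1, some e_i lies
    outside N; since e_i lies in every ideal pulled back from a factor other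
    than R_i, this i is unique.  Hence Max(P) is partitioned into the closed
    images of the finitely many Max(R_i) ([pullback_total_bij]).

    Continuous functions on the pieces of a finite closed partition glue to a
    unique continuous function, because the preimage of a closed set is a finite
    union of closed sets ([glue_continuous]).  So restriction to the pieces is a
    bijection from C(Max(P)) to the product of the C(Max(R_i)), and it is a ring
    morphism since all operations are pointwise ([ring_isomorphic_restrict]). *)

Set Implicit Arguments.
Unset Strict Implicit.
Unset Printing Implicit Defensive.

Import Order.TTheory GRing.Theory Num.Theory.

Local Open Scope classical_set_scope.
Local Open Scope ring_scope.

(** * Maximal ideals along a surjection *)

Section IdealBasics.
Context {A : comPzRingType}.

Lemma ideal1_setT (I : set A) : is_ideal I -> I 1 -> I = setT.
Proof.
by case=> _ _ IM I1; apply/seteqP; split=> // x _; rewrite -[x]mulr1; exact: IM.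
Qed.

Lemma maximal_ideal_not1 (M : set A) : is_maximal_ideal M -> ~ M 1.
Proof. by case=> idM /eqP MT _ /(ideal1_setT idM). Qed.

Lemma Max_eq (M N : Max A) : (M : set A) = N -> M = N.
Proof.
case: M N => [M HM] [N HN] /= MN; case: N / MN HN => HN.
by congr MkMax; exact: Prop_irrelevance.
Qed.

End IdealBasics.

Section Surjection.
Context {A B : comPzRingType} (q : {rmorphism A -> B}).
Hypothesis q_surj : range q = setT.

Lemma ideal_preimage (J : set B) : is_ideal J -> is_ideal (q @^-1` J).
Proof.
case=> J0 JD JM; split=> /= [|x y|a x]; first by rewrite rmorph0.
- by rewrite rmorphD; exact: JD.
- by rewrite rmorphM; exact: JM.
Qed.

Lemma ideal_image (I : set A) : is_ideal I -> is_ideal (q @` I).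
Proof.
case=> I0 ID IM; split.
- by exists 0; rewrite ?rmorph0.
- by move=> _ _ [x Ix <-] [y Iy <-]; exists (x + y); rewrite ?rmorphD //; exact: ID.
- move=> b _ [x Ix <-]; have [a _ <-] : range q b by rewrite q_surj.
  by exists (a * x); rewrite ?rmorphM //; exact: IM.
Qed.

Lemma preimage_image_ideal (I : set A) : is_ideal I ->
  q @^-1` [set 0] `<=` I -> q @^-1` (q @` I) = I.
Proof.
case=> _ ID _ kerI; apply/seteqP; split=> [x [y Iy qyx]|x Ix]; last by exists x.
rewrite -(subrK y x); apply: ID => //; apply: kerI.
by rewrite /preimage /= rmorphB qyx subrr.
Qed.

(** An ideal above the preimage of [M] contains the kernel, hence is the preimage
    of its own image, and that image is an ideal above [M]. *)
Lemma maximal_ideal_preimage (M : set B) :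
  is_maximal_ideal M -> is_maximal_ideal (q @^-1` M).
Proof.
move=> maxM; have [idM _ Mmax] := maxM; split; first exact: ideal_preimage.
  apply/eqP => qMT; apply: (maximal_ideal_not1 maxM).
  by rewrite -(rmorph1 q) -[M _]/((q @^-1` M) 1) qMT.
move=> I idI MI.
have kerI : q @^-1` [set 0] `<=` I.
  by move=> x /= qx0; apply: MI; rewrite /preimage /= qx0; case: idM.
have MqI : M `<=` q @` I.
  by rewrite -(image_preimage M q_surj); exact: image_subset.
rewrite -(preimage_image_ideal idI kerI).
by case: (Mmax _ (ideal_image idI) MqI) => ->; [left|right].
Qed.

(** An ideal above [q @` N] is the image of its preimage, which lies above [N].
    Containing the kernel is what keeps the image of [N] proper. *)
Lemma maximal_ideal_image (N : set A) : is_maximal_ideal N ->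
  q @^-1` [set 0] `<=` N -> is_maximal_ideal (q @` N).
Proof.
move=> maxN kerN; have [idN _ Nmax] := maxN.
have qNK := preimage_image_ideal idN kerN.
split; first exact: ideal_image.
  apply/eqP => qNT; apply: (maximal_ideal_not1 maxN).
  by rewrite -qNK qNT.
move=> J idJ NJ.
have NqJ : N `<=` q @^-1` J by rewrite -qNK; exact: preimage_subset.
rewrite -(image_preimage J q_surj).
by case: (Nmax _ (ideal_preimage idJ) NqJ) => ->; [left|right].
Qed.

Definition pullback (M : Max B) : Max A :=
  MkMax (maximal_ideal_preimage (ideal_of_MaxP M)).

Lemma pullback_inj : injective pullback.
Proof.
move=> M N /(congr1 (@ideal_of_Max A)) /= qMN; apply: Max_eq.
by rewrite -(image_preimage M q_surj) qMN image_preimage.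
Qed.

Lemma pullback_of_ker (N : Max A) :
  q @^-1` [set 0] `<=` N -> exists M, pullback M = N.
Proof.
move=> kerN; have maxN := ideal_of_MaxP N; have [idN _ _] := maxN.
exists (MkMax (maximal_ideal_image maxN kerN)); apply: Max_eq => /=.
exact: preimage_image_ideal.
Qed.

Lemma pullback_continuous : continuous pullback.
Proof.
apply/continuous_closedP => C /closed_MaxP[S ->]; apply/closed_MaxP.
exists (q @` S); apply/seteqP; split=> M SM.
  by move=> _ [s Ss <-]; exact: SM.
by move=> s Ss; apply: SM; exists s.
Qed.

Lemma pullback_closed (C : set (Max B)) : closed C -> closed (pullback @` C).
Proof.
move=> /closed_MaxP[S ->]; apply/closed_MaxP.
(* Adjoining 0 leaves the closed set of S unchanged, and forces the maximal
   ideals containing the preimage to contain the kernel. *)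
exists (q @^-1` (0 |` S)); apply/seteqP; split=> [_ [M SM <-] x /= [qx0|]|N SN].
- by rewrite /preimage /= qx0; have [[]] := ideal_of_MaxP M.
- exact: SM.
- have [|M MN] := @pullback_of_ker N.
    by move=> x qx0; apply: SN; left.
  exists M => // s Ss; have [a _ qas] : range q s by rewrite q_surj.
  rewrite -qas -[ideal_of_Max M _]/((pullback M : set A) a) MN.
  by apply: SN; right; rewrite /= qas.
Qed.

End Surjection.

(** * The maximal spectrum of a finite product *)

Section ProductSpectrum.
Context {I : finType} {A : I -> comPzRingType}.
Local Notation prodA := {dffun forall i : I, A i}.

Definition prod_proj (i : I) (f : prodA) : A i := f i.

Lemma prod_proj_zmod_morphism i : zmod_morphism (prod_proj i).
Proof. by move=> f g; rewrite /prod_proj prodrDE prodrNE. Qed.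

Lemma prod_proj_monoid_morphism i : monoid_morphism (prod_proj i).
Proof.
by split=> [|f g]; [exact: prodr1E|exact: prodrME].
Qed.

HB.instance Definition _ i :=
  GRing.isZmodMorphism.Build prodA (A i) (prod_proj i)
    (prod_proj_zmod_morphism i).
HB.instance Definition _ i :=
  GRing.isMonoidMorphism.Build prodA (A i) (prod_proj i)
    (prod_proj_monoid_morphism i).

Definition prod_idem (i : I) : prodA := [ffun j => (j == i)%:R : A j].

Lemma prod_sumE (s : seq I) (F : I -> prodA) j :
  (\sum_(i <- s) F i) j = \sum_(i <- s) F i j.
Proof. exact: (raddf_sum (prod_proj j)). Qed.

Lemma sum_prod_idem : \sum_i prod_idem i = 1.
Proof.
apply/ffunP => j; rewrite prod_sumE prodr1E (bigD1 j) //= ffunE eqxx big1.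
  by rewrite addr0.
by move=> i /negPf ij; rewrite ffunE eq_sym ij.
Qed.

Lemma prod_proj_surj i : range (prod_proj i) = setT.
Proof.
apply/seteqP; split=> // a _.
(* The vector with entry a at i and 0 elsewhere; at j = i the value a has to be
   cast from A i to A j. *)
pose F j : A j := if eqP is ReflectT e then ecast k (A k) e a else 0.
exists [ffun j => F j] => //.
rewrite /prod_proj ffunE /F; case: eqP => // e.
by rewrite (eq_irrelevance e erefl).
Qed.

(** If f vanishes at i then f * e_i = 0 lies in the prime ideal [N]. *)
Lemma prod_ker_sub (N : Max prodA) i :
  ~ (N : set prodA) (prod_idem i) -> prod_proj i @^-1` [set 0] `<=` N.
Proof.
move=> nNi f /= fi0; have maxN := ideal_of_MaxP N; have [[N0 _ _] _ _] := maxN.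
suff fe0 : f * prod_idem i = 0.
  by have [] // := @maximal_ideal_prime _ _ f (prod_idem i) maxN; rewrite fe0.
apply/ffunP => j; rewrite prodrME prodr0E ffunE.
case: eqP => [->|_]; last by rewrite mulr0.
by rewrite -[f i]/(prod_proj i f) fi0 mul0r.
Qed.

Lemma maximal_ideal_missing_idem (N : Max prodA) :
  exists i, ~ (N : set prodA) (prod_idem i).
Proof.
apply/existsNP => Ne; have maxN := ideal_of_MaxP N; have [[N0 ND _] _ _] := maxN.
apply: (maximal_ideal_not1 maxN); rewrite -sum_prod_idem.
by elim/big_ind: _ => // i _; exact: Ne.
Qed.

Definition pullback_total (u : {i : I & Max (A i)}) : Max prodA :=
  pullback (prod_proj_surj (tag u)) (tagged u).

(** Pullbacks from distinct factors i and j differ: e_i belongs to the pullback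
    from j, as its j-th component is 0, but not to the one from i. *)
Lemma pullback_total_inj : injective pullback_total.
Proof.
move=> [i M] [j N]; rewrite /pullback_total /=.
have [ij|/eqP ij] := eqVneq i j.
  by case: j / ij N => N /pullback_inj ->.
move=> /(congr1 (@ideal_of_Max _)) /= MN.
have : (prod_proj i @^-1` M) (prod_idem i).
  rewrite MN /preimage /= /prod_proj ffunE.
  have /eqP/negPf -> : j <> i by move=> /esym.
  by have [[]] := ideal_of_MaxP N.
rewrite /preimage /= /prod_proj ffunE eqxx.
by move=> /(maximal_ideal_not1 (ideal_of_MaxP M)).
Qed.

Lemma pullback_total_bij : bijective pullback_total.
Proof.
have /choice[unpull unpullK] : forall N, exists u, pullback_total u = N.
  move=> N; have [i nNi] := maximal_ideal_missing_idem N.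
  have [M MN] := pullback_of_ker (prod_proj_surj i) (prod_ker_sub nNi).
  by exists (Tagged (Max \o A) M).
exists unpull => // u; apply: pullback_total_inj; exact: unpullK.
Qed.

End ProductSpectrum.

(** * Continuous functions on a finite closed partition *)

Section FiniteClosedPartition.
Context {K : realType} {I : finType} {X : topologicalType}.
Context {Y : I -> topologicalType} (j : forall i, Y i -> X).
Hypothesis j_cont : forall i, continuous (@j i).
Hypothesis j_closed : forall i (C : set (Y i)), closed C -> closed (@j i @` C).

Let j_total (u : {i : I & Y i}) : X := j (tagged u).

(** Finiteness of [I] enters here: the preimage of a closed set is the union over
    [I] of the images of its closed traces on the pieces. *)
Lemma glue_continuous (pt : X -> {i : I & Y i})
    (g : {dffun forall i : I, continuousType (Y i) K}) :
  cancel j_total pt -> cancel pt j_total ->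
  continuous (fun x => g (tag (pt x)) (tagged (pt x))).
Proof.
move=> jK ptK; apply/continuous_closedP => C closedC.
rewrite (_ : _ @^-1` C = \bigcup_i (@j i @` (g i @^-1` C))).
  apply: closed_bigcup => [|i _]; first exact: finite_finset.
  apply: j_closed; move: C closedC; apply/continuous_closedP; exact: cts_fun.
apply/seteqP; split=> [x /= Cx|_ [i _ [y Cy <-]]].
  exists (tag (pt x)) => //; exists (tagged (pt x)) => //; exact: ptK.
by rewrite /preimage /= -[j y]/(j_total (Tagged Y y)) jK.
Qed.

Definition restrict (f : continuousType X K) :
    {dffun forall i : I, continuousType (Y i) K} :=
  [ffun i => mkcts (fun y => continuous_comp (@j_cont i y) (@cts_fun _ _ f _))
     : continuousType (Y i) K].

Lemma restrictE f i y : restrict f i y = f (j y).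
Proof. by rewrite ffunE. Qed.

Lemma restrict_zmod_morphism : zmod_morphism restrict.
Proof.
move=> f g; apply/ffunP => i; apply/continuousEP => y.
by rewrite prodrDE prodrNE contDE contNE !restrictE.
Qed.

Lemma restrict_monoid_morphism : monoid_morphism restrict.
Proof.
split=> [|f g]; apply/ffunP => i; apply/continuousEP => y.
  by rewrite prodr1E restrictE.
by rewrite prodrME contME !restrictE.
Qed.

HB.instance Definition _ := GRing.isZmodMorphism.Build _ _ restrict
  restrict_zmod_morphism.
HB.instance Definition _ := GRing.isMonoidMorphism.Build _ _ restrict
  restrict_monoid_morphism.

Lemma ring_isomorphic_restrict : bijective j_total ->
  ring_isomorphic (continuousType X K)
    {dffun forall i : I, continuousType (Y i) K}.
Proof.
case=> pt jK ptK; exists restrict.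
exists (fun g => mkcts (@glue_continuous pt g jK ptK) : continuousType X K)
  => [f|g].
  by apply/continuousEP => x; rewrite /= /mkcts restrictE -/(j_total (pt x)) ptK.
apply/ffunP => i; apply/continuousEP => y; rewrite restrictE /= /mkcts.
by rewrite -[j y]/(j_total (Tagged Y y)) jK.
Qed.

End FiniteClosedPartition.

(** * Functions on the spectrum of a product *)

Theorem proposition4p15 (K : realType) (n : nat) (R : 'I_n -> comPzRingType) :
  ring_isomorphic
    (continuousType (Max {dffun forall i : 'I_n, R i}) K)
    {dffun forall i : 'I_n, continuousType (Max (R i)) K}.
Proof.
apply: (@ring_isomorphic_restrict K 'I_n (Max {dffun forall i : 'I_n, R i})
  (fun i => Max (R i)) (fun i => pullback (prod_proj_surj i))).
- by move=> i; exact: pullback_continuous.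
- by move=> i C; exact: pullback_closed.
- exact: pullback_total_bij.
Qed.
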